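(* Let $P,Q\in L_1(0,\pi)$ be complex-valued and let $E(t,\lambda)=(e_{jk}(t,\lambda))_{j,k=1}^2$ be the fundamental matrix of the Dirac system, normalized by $E(0,\lambda)=I$ (see context). Then for every $\lambda\in\mathbb{C}$ and every $t\in[0,\pi]$ the following representations are valid: $$e_{12}(t,\lambda)=-ie^{i\lambda t}\sum_{n=0}^\infty p_n(t,\lambda),\qquad e_{21}(t,\lambda)=ie^{-i\lambda t}\sum_{n=0}^\infty q_n(t,\lambda),$$ $$e_{11}(t,\lambda)=e^{i\lambda t}\sum_{n=0}^\infty g_n(t,\lambda),\qquad e_{22}(t,\lambda)=e^{-i\lambda t}\sum_{n=0}^\infty h_n(t,\lambda),$$ where for any $\lambda$ the series on the right-hand sides converge absolutely and uniformly in $t$ on the segment $[0,\pi]$.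
   Context: The Dirac system is $B\mathbf{y}'+V\mathbf{y}=\lambda\mathbf{y}$ on $[0,\pi]$ with $\mathbf{y}=\mathrm{col}(y_1,y_2)$, $B=\begin{pmatrix} -i & 0 \\ 0 & i \end{pmatrix}$, $V=\begin{pmatrix} 0 & P(x) \\ Q(x) & 0 \end{pmatrix}$; i.e. $-iy_1'+Py_2=\lambda y_1$, $iy_2'+Qy_1=\lambda y_2$ (solutions are absolutely continuous and satisfy the equations almost everywhere). $E(x,\lambda)=\begin{pmatrix} e_{11} & e_{12} \\ e_{21} & e_{22} \end{pmatrix}(x,\lambda)$ is the matrix whose columns are solutions of this system and which satisfies $E(0,\lambda)=I$, $I$ being the unit matrix. Iterated integrals: for $n\ge0$, $$p_n(t,\lambda)=\int_0^t e^{-2i\lambda t_1}P(t_1)\,dt_1\int_0^{t_1}e^{2i\lambda t_2}Q(t_2)\,dt_2\cdots\int_0^{t_{2n}}e^{-2i\lambda t_{2n+1}}P(t_{2n+1})\,dt_{2n+1},$$ $$q_n(t,\lambda)=\int_0^t e^{2i\lambda t_1}Q(t_1)\,dt_1\int_0^{t_1}e^{-2i\lambda t_2}P(t_2)\,dt_2\cdots\int_0^{t_{2n}}e^{2i\lambda t_{2n+1}}Q(t_{2n+1})\,dt_{2n+1}$$ (with $2n+1$ nested integrations, the factors $e^{-2i\lambda t_j}P(t_j)$ and $e^{2i\lambda t_j}Q(t_j)$ alternating; in particular $p_0(t,\lambda)=\int_0^te^{-2i\lambda t_1}P(t_1)dt_1$, $q_0(t,\lambda)=\int_0^te^{2i\lambda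 t_1}Q(t_1)dt_1$). Further $g_0(t,\lambda)=h_0(t,\lambda)=1$ and for $n\ge1$ $$g_n(t,\lambda)=\int_0^t e^{-2i\lambda t_1}P(t_1)\,dt_1\int_0^{t_1}e^{2i\lambda t_2}Q(t_2)\,dt_2\cdots\int_0^{t_{2n-2}}e^{-2i\lambda t_{2n-1}}P(t_{2n-1})\,dt_{2n-1}\int_0^{t_{2n-1}}e^{2i\lambda t_{2n}}Q(t_{2n})\,dt_{2n},$$ $$h_n(t,\lambda)=\int_0^t e^{2i\lambda t_1}Q(t_1)\,dt_1\int_0^{t_1}e^{-2i\lambda t_2}P(t_2)\,dt_2\cdots\int_0^{t_{2n-2}}e^{2i\lambda t_{2n-1}}Q(t_{2n-1})\,dt_{2n-1}\int_0^{t_{2n-1}}e^{-2i\lambda t_{2n}}P(t_{2n})\,dt_{2n}$$ (with $2n$ nested, alternating integrations; when $n=1$ the outermost integral is over $[0,t]$). *)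

(* Defs.v *)
(* MathComp-Analysis over an abstract realType R.  R[i] is not a normed module
   over R there, so calculus for functions R -> R[i] is set up componentwise,
   on real and imaginary parts. *)
From mathcomp Require Import all_boot all_order all_algebra.
From mathcomp Require Import complex.
From mathcomp Require Import all_classical all_reals all_analysis.
Set Implicit Arguments.
Unset Strict Implicit.
Unset Printing Implicit Defensive.
Import Order.TTheory GRing.Theory Num.Theory.
Import numFieldNormedType.Exports.
Local Open Scope classical_set_scope.
Local Open Scope ring_scope.

Section ComplexValued.
Variable R : realType.
Implicit Types (z : R[i]) (f : R -> R[i]) (D : set R).

Definition cexp z : R[i] :=
  Complex (expR (complex.Re z) * cos (complex.Im z))
          (expR (complex.Re z) * sin (complex.Im z)).

(* Borel measurable with Lebesgue integrable modulus: every class in L_1(D)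
   has such a representative. *)
Definition cintegrable D f : Prop :=
  lebesgue_measure.-integrable D (fun x => (complex.Re (f x))%:E) /\
  lebesgue_measure.-integrable D (fun x => (complex.Im (f x))%:E).

Definition cintegral D f : R[i] :=
  Complex (\int[lebesgue_measure]_(x in D) complex.Re (f x))
          (\int[lebesgue_measure]_(x in D) complex.Im (f x)).

Definition cderivable f (x : R) : Prop :=
  derivable (fun s => complex.Re (f s)) x 1 /\
  derivable (fun s => complex.Im (f s)) x 1.

Definition cderive f (x : R) : R[i] :=
  Complex (derive1 (fun s => complex.Re (f s)) x)
          (derive1 (fun s => complex.Im (f s)) x).

Definition abs_continuous (a b : R) f : Prop :=
  forall e : R, 0 < e -> exists2 d : R, 0 < d &
    forall (n : nat) (u v : 'I_n -> R),
      (forall i, [/\ a <= u i, u i <= v i & v i <= b]) ->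
      trivIset setT (fun i => `]u i, v i[%classic) ->
      \sum_(i < n) (v i - u i) < d ->
      \sum_(i < n) Normc.normc (f (v i) - f (u i)) < e.

(* R[i]^o carries the topology given by the modulus. *)
Definition csum (u : nat -> R[i]) : R[i] :=
  limn (series (u : nat -> R[i]^o)).

Definition cvg_abs_unif D (u : nat -> R -> R[i]) : Prop :=
  (forall t, D t -> cvgn (series (fun n => Normc.normc (u n t)))) /\
  {uniform D, (fun n t => series (fun k => u k t : R[i]^o) n) @ \oo -->
              (fun t => csum (fun k => u k t) : R[i]^o)}.

End ComplexValued.

Section Dirac.
Variable R : realType.
Variables P Q : R -> R[i].

Definition dirac_B : 'M[R[i]]_2 :=
  \matrix_(j, k) (if j != k then 0 else if j == 0 then - 'i%C else 'i%C).

Definition dirac_V (x : R) : 'M[R[i]]_2 :=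
  \matrix_(j, k) (if j == k then 0 else if j == 0 then P x else Q x).

Definition dirac_solution (lambda : R[i]) (y : R -> 'cV[R[i]]_2) : Prop :=
  (forall j, abs_continuous 0 pi (fun x => y x j 0)) /\
  {ae lebesgue_measure, forall x : R, x \in `]0, pi[ ->
    (forall j, cderivable (fun s => y s j 0) x) /\
    dirac_B *m (\col_j cderive (fun s => y s j 0) x) + dirac_V x *m y x
      = lambda *: y x}.

Definition fundamental_matrix (E : R -> R[i] -> 'M[R[i]]_2) : Prop :=
  forall lambda,
    (forall k, dirac_solution lambda (fun x => col k (E x lambda))) /\
    E 0 lambda = 1%:M.

(* The m-fold integral
   \int_0^t a(t_1) dt_1 \int_0^{t_1} b(t_2) dt_2 \int_0^{t_2} a(t_3) dt_3 ...
   with alternating weights a, b, a, ...; the empty one (m = 0) is 1. *)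
Fixpoint alt_integral (a b : R -> R[i]) (m : nat) (t : R) : R[i] :=
  if m is m'.+1
  then cintegral `[0, t] (fun s => a s * alt_integral b a m' s)
  else 1.

Definition wP (lambda : R[i]) (s : R) : R[i] :=
  cexp (- (2 * 'i%C * lambda * s%:C%C)) * P s.

Definition wQ (lambda : R[i]) (s : R) : R[i] :=
  cexp (2 * 'i%C * lambda * s%:C%C) * Q s.

Definition p_int (n : nat) (t : R) (lambda : R[i]) : R[i] :=
  alt_integral (wP lambda) (wQ lambda) (2 * n + 1)%N t.

Definition q_int (n : nat) (t : R) (lambda : R[i]) : R[i] :=
  alt_integral (wQ lambda) (wP lambda) (2 * n + 1)%N t.

Definition g_int (n : nat) (t : R) (lambda : R[i]) : R[i] :=
  alt_integral (wP lambda) (wQ lambda) (2 * n)%N t.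

Definition h_int (n : nat) (t : R) (lambda : R[i]) : R[i] :=
  alt_integral (wQ lambda) (wP lambda) (2 * n)%N t.

End Dirac.

(* Main.v *)
(* Put u = exp(-i lambda t) y_1 and v = exp(i lambda t) y_2. The Dirac system
   becomes u' = -i a v, v' = i b u with a = exp(-2 i lambda t) P and
   b = exp(2 i lambda t) Q, that is, by the fundamental theorem of calculus for
   absolutely continuous functions, u = u(0) - i \int a v, v = v(0) + i \int b u.
   Substituting the two equations into each other m times yields the partial
   sums of the series plus a remainder given by an m-fold iterated integral,
   which is at most M W(t)^m / m! with W(t) = \int_0^t (|a| + |b|). Since E is
   given, this bound alone proves uniform convergence and identifies the sums;
   no completeness of R[i] is needed.
   The fundamental theorem reduces to the fact that an absolutely continuous f
   with f' = 0 almost everywhere is constant: cover the exceptional null set by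
   an open set of small measure and propagate along the interval a bound of
   |f(x) - f(a)| by e (x - a) plus the increments of f over disjoint
   intervals inside that open set. *)
Require Import Defs.
From mathcomp Require Import all_boot all_order all_algebra complex.
From mathcomp Require Import ring lra.
From mathcomp Require Import all_classical all_reals all_analysis.
Import Order.TTheory GRing.Theory Num.Theory.
Import numFieldNormedType.Exports.
Local Open Scope classical_set_scope.
Local Open Scope ring_scope.
Set Implicit Arguments.
Unset Strict Implicit.
Unset Printing Implicit Defensive.

(** * Absolutely continuous real functions *)

Section AbsoluteContinuity.
Variable R : realType.
Implicit Types (a b : R) (f g F : R -> R).
Notation mu := (@lebesgue_measure R).

(** Take the supremum of the points of [[a, b]] where [S] holds. The local step carries [S] from a
    point just left of the supremum to any nearby point on its right, so the supremum cannot lie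
    below [b]. Both [x = c] and [y = c] are allowed in the step, which covers the two ends of the
    interval. *)
Lemma real_induction a b (S : R -> Prop) : a <= b -> S a ->
  (forall c, a <= c <= b -> exists2 r : R, 0 < r &
    forall x y, a <= x <= c -> c <= y <= b -> c - r < x -> y < c + r ->
      S x -> S y) ->
  S b.
Proof.
move=> ab Sa loc.
pose A : set R := [set x | a <= x <= b /\ S x].
have Aa : A a by split; rewrite ?lexx.
have ubA : ubound A b by move=> x [/andP[]].
have supA : has_sup A by split; [exists a | exists b].
have ac : a <= sup A by exact: (ub_le_sup (ex_intro _ b ubA) Aa).
have cb : sup A <= b by apply: ge_sup => //; exists a.
have [|r r0 step] := loc (sup A); first by rewrite ac cb.
have [x [/andP[ax xb] Sx] cx] := sup_adherent r0 supA.
have xc : x <= sup A.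
  by apply: (ub_le_sup (ex_intro _ b ubA)); rewrite /A/= ax xb.
have [cltb|] := ltP (sup A) b; last first.
  by move=> bc; apply: (step x) => //; rewrite ?ax ?bc ?lexx//; lra.
(* A point beyond the supremum, still in [[a, b]] and within reach of the local step: it will belong
   to [A], a contradiction. *)
pose y := Num.min b (sup A + r / 2).
have cy : sup A < y by rewrite lt_min cltb /=; lra.
have yb : y <= b by rewrite ge_min lexx.
suff Ay : A y by have := ub_le_sup (ex_intro _ b ubA) Ay; rewrite leNgt cy.
split; first by rewrite yb andbT; lra.
apply: (step x) => //; rewrite ?ax ?yb ?andbT //; first exact: ltW.
by rewrite gt_min; apply/orP; right; lra.
Qed.

(** Complex absolute continuity is studied through this condition on the real and imaginary
    parts. *)
Definition real_ac a b f := forall e : R, 0 < e -> exists2 d : R, 0 < d &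
  forall n (u v : 'I_n -> R),
    (forall i, [/\ a <= u i, u i <= v i & v i <= b]) ->
    trivIset setT (fun i => `]u i, v i[%classic) ->
    \sum_(i < n) (v i - u i) < d ->
    \sum_(i < n) `|f (v i) - f (u i)| < e.

Lemma real_acS a b a' b' f : a <= a' -> b' <= b ->
  real_ac a b f -> real_ac a' b' f.
Proof.
move=> aa bb acf e /acf[d d0 dP]; exists d => // n u v uv; apply: dP => i.
by have [? ? ?] := uv i; split=> //; lra.
Qed.

Lemma real_ac_unif_continuous a b f : real_ac a b f -> forall e : R, 0 < e ->
  exists2 d : R, 0 < d & forall x y, a <= x <= b -> a <= y <= b ->
    `|x - y| < d -> `|f x - f y| < e.
Proof.
move=> acf e /acf[d d0 dP]; exists d => // x y xab yab xy.
wlog yx : x y xab yab xy / y <= x.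
  move=> H; have [yx|/ltW xy'] := leP y x; first exact: H.
  by rewrite distrC; apply: H => //; rewrite distrC.
have := dP 1%N (fun=> y) (fun=> x); rewrite !big_ord1; apply => //.
- by move=> _; split=> //; lra.
- by move=> i j _ _ _; rewrite !ord1.
- by move: xy; rewrite ger0_norm ?subr_ge0.
Qed.

Lemma real_ac_continuous a b f : a <= b -> real_ac a b f ->
  {within `[a, b], continuous f}.
Proof.
move=> ab acf; apply/subspace_continuousP => x xab; apply/cvgrPdist_lt => e e0.
have [d d0 dP] := real_ac_unif_continuous acf e0.
rewrite !near_withinE; near=> y => /= yab.
move: xab yab; rewrite /= !in_itv/= => xab yab.
apply: dP => //; near: y; apply: nbhsx_ballx => //.
Unshelve. all: by end_near. Qed.

Lemma measure_itv_bigsetU n (u v : 'I_n -> R) : (forall i, u i <= v i) ->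
  trivIset setT (fun i => `]u i, v i[%classic) ->
  mu (\big[setU/set0]_(i < n) `]u i, v i[%classic) = (\sum_(i < n) (v i - u i))%:E.
Proof.
move=> uv tuv; transitivity (\sum_(i < n) mu `]u i, v i[)%E.
  by rewrite -measure_bigsetU_ord.
rewrite -sumEFin; apply: eq_bigr => i _.
rewrite lebesgue_measure_itv/= lte_fin lt_neqAle uv andbT.
by case: eqP => [->|] //; rewrite subrr.
Qed.

Lemma sum_itv_le (U : set R) n (u v : 'I_n -> R) :
  measurable U -> (forall i, u i <= v i) ->
  trivIset setT (fun i => `]u i, v i[%classic) ->
  (forall i, `]u i, v i[ `<=` U) ->
  ((\sum_(i < n) (v i - u i))%:E <= mu U)%E.
Proof.
move=> mU uv tuv uvU; rewrite -measure_itv_bigsetU//.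
apply: le_measure; rewrite ?inE//.
  by apply: bigsetU_measurable => i _; exact: measurable_itv.
by rewrite -bigcup_seq; apply: bigcup_sub => i _; exact: uvU.
Qed.

(** Carathéodory's form of the derivative, [f x - f c = g x * (x - c)] with [g] continuous at [c]
    and [g c = 0], gives the bound without division by [x - c]. *)
Lemma is_derive0_local f c e : is_derive c (1 : R) f 0 -> 0 < e ->
  exists2 r : R, 0 < r & forall x, `|x - c| < r -> `|f x - f c| <= e * `|x - c|.
Proof.
move=> /is_derive1_caratheodory[g [fg gc g0]] e0.
have /cvgrPdist_lt/(_ _ e0)[r /= r0 rP] := gc.
exists r => // x xc; rewrite fg normrM ler_wpM2r//.
by have := rP x; rewrite /= g0 sub0r normrN distrC => /(_ xc)/ltW.
Qed.

(* S x: |f x - f a| is bounded by e (x - a) plus the increments of f over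
   disjoint intervals contained in the open cover U of the exceptional set. *)
Lemma real_ac_derive0_end a b f : a <= b -> real_ac a b f ->
  {ae mu, forall x, x \in `]a, b[ -> is_derive x (1 : R) f 0} -> f b = f a.
Proof.
move=> ab acf [N [mN N0 Nsub]].
(* The part [e * (b - a)] will come from the points with zero derivative, the extra [e] from
   absolute continuity on the open cover. *)
suff fab e : 0 < e -> `|f b - f a| <= e * (b - a + 1).
  apply/eqP; rewrite -subr_eq0 -normr_le0; apply/ler_addgt0Pl => e e0.
  rewrite addr0; have ba1 : 0 < b - a + 1 by lra.
  by have := fab (e / (b - a + 1)); rewrite divr_gt0// divfK ?gt_eqF//; apply.
move=> e0; have [d d0 dP] := acf _ e0.
(* The derivative is controlled only inside the open interval, so the endpoints join the exceptional
   set. *)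
pose N' := N `|` [set a; b].
have mN' : measurable N' by apply: measurableU => //; apply: measurableU.
have N'0 : mu N' = 0%E.
  by apply: null_set_setU => //; [exact: measurableU|
    apply: null_set_setU => //; exact: lebesgue_measure_set1].
have [U [oU N'U muU]] : exists U : set R, [/\ open U, N' `<=` U & (mu U < d%:E)%E].
  have N'oo : (mu N' < +oo)%E by rewrite [mu _]N'0.
  (* Outer regularity bounds the measure of [U] minus [N']; since [N'] is null, the same bound holds
     for [U]. *)
  have [U [oU N'U UN]] := lebesgue_regularity_outer mN' N'oo d0.
  exists U; split=> //; apply: le_lt_trans UN.
  have mU := measurable_realfun.open_measurable oU.
  rewrite -[X in (mu X <= _)%E](setDUK N'U) setUC measureU0//.
  exact: measurableD.
have derN c : a <= c <= b -> ~ U c -> is_derive c (1 : R) f 0.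
  move=> cab Uc; apply: contrapT => fc; apply: Uc; apply: N'U.
  have [->|ca] := eqVneq c a; first by right; left.
  have [->|cb] := eqVneq c b; first by right; right.
  left; apply: Nsub => /= H; apply: fc; apply: H.
  by rewrite in_itv/= !lt_neqAle eq_sym ca cb.
pose S x := exists n (u v : nat -> R), [/\
  forall i, (i < n)%N -> [/\ a <= u i, u i <= v i & v i <= x],
  trivIset `I_n (fun i => `]u i, v i[%classic),
  forall i, (i < n)%N -> `]u i, v i[ `<=` U &
  `|f x - f a| <= e * (x - a) + \sum_(i < n) `|f (v i) - f (u i)|].
suff [n [u [v [uvab tuv uvU fab]]]] : S b.
  apply: (le_trans fab).
  have -> : e * (b - a + 1) = e * (b - a) + e by ring.
  rewrite lerD2l ltW//.
  (* In [S] the families are indexed by [nat], which makes appending an interval easy; absolute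
     continuity wants them over ['I_n]. *)
  pose u' (i : 'I_n) := u i; pose v' (i : 'I_n) := v i.
  have uvab' i : [/\ a <= u' i, u' i <= v' i & v' i <= b] by exact: uvab.
  have tuv' : trivIset setT (fun i => `]u' i, v' i[%classic).
    by move=> i j _ _ ij; apply: val_inj; apply: tuv => //=.
  apply: dP => //; rewrite -lte_fin; apply: le_lt_trans muU.
  apply: sum_itv_le => //; first exact: measurable_realfun.open_measurable.
  - by move=> i; have [] := uvab' i.
  - by move=> i; exact: uvU.
apply: (real_induction ab).
  exists 0%N, (fun=> 0), (fun=> 0); split=> //.
  by rewrite !subrr normr0 mulr0 big_ord0 addr0.
(* Outside [U] the derivative at [c] vanishes and the family stays as it is: since [x <= c <= y],
   the errors of [f x] and [f y] against [f c] add up to at most [e * (y - x)]. *)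
move=> c cab; have [Uc|nUc] := pselect (U c); last first.
  have [r r0 rP] := is_derive0_local (derN _ cab nUc) e0.
  exists r => // x y axc cyb cx yc [n [u [v [uvx tuv uvU fx]]]].
  exists n, u, v; split=> //.
    by move=> i /uvx[? ? ?]; split=> //; lra.
  have -> : f y - f a = (f y - f c) - (f x - f c) + (f x - f a) by lra.
  rewrite (le_trans (ler_normD _ _))//.
  have fyx : `|f y - f c - (f x - f c)| <= e * (y - x).
    rewrite (le_trans (ler_normB _ _))//.
    have yx : e * (y - x) = e * `|y - c| + e * `|x - c|.
      by rewrite ger0_norm ?ler0_norm; [ring|lra|lra].
    by rewrite yx lerD//; apply: rP; rewrite ltr_norml; lra.
  have -> : e * (y - a) = e * (y - x) + e * (x - a) by ring.
  by rewrite -[leRHS]addrA lerD.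
have /nbhs_ballP[r /= r0 rU] : nbhs c U by exact: open_nbhs_nbhs.
exists r => // x y axc cyb cx yc [n [u [v [uvx tuv uvU fx]]]].
(* Inside [U] the interval []x, y[] is appended at index [n]. It lies in a ball contained in [U],
   and it meets no earlier interval because those end at [x] or before. *)
pose u' i := if i == n then x else u i; pose v' i := if i == n then y else v i.
exists n.+1, u', v'; split.
- move=> i; rewrite /u' /v'; case: eqP => [_ _|/eqP ni]; first by split; lra.
  by rewrite ltnS leq_eqVlt (negbTE ni) => /uvx[? ? ?]; split; lra.
- have disj i z : (i < n)%N -> `]u i, v i[%classic z -> `]x, y[%classic z -> False.
    by rewrite /= !in_itv/= => /uvx[? ? ?] ? ?; lra.
  move=> i j /= iS jS [z []]; rewrite /u' /v'.
  case: eqP => [->|/eqP ni]; case: eqP => [->|/eqP nj] //.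
  + by move=> ? /disj H; exfalso; apply: H; first by rewrite ltn_neqAle nj.
  + by move=> /disj H ?; exfalso; apply: H; first by rewrite ltn_neqAle ni.
  + move=> zi zj; apply: tuv; rewrite /= ?ltn_neqAle ?ni ?nj//.
    by exists z.
- move=> i; rewrite /u' /v'; case: eqP => [_ _|/eqP ni].
    move=> z; rewrite /= in_itv/= => xzy; apply: rU.
    by rewrite /ball/= ltr_norml; lra.
  by rewrite ltnS leq_eqVlt (negbTE ni) => /uvU.
- rewrite big_ord_recr/= {2}/u' {2}/v' eqxx.
  have -> : \sum_(i < n) `|f (v' i) - f (u' i)| = \sum_(i < n) `|f (v i) - f (u i)|.
    by apply: eq_bigr => i _; rewrite /u' /v' ltn_eqF.
  have -> : f y - f a = (f y - f x) + (f x - f a) by lra.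
  rewrite (le_trans (ler_normD _ _))// [leLHS]addrC [leRHS]addrA lerD2r (le_trans fx)//.
  by rewrite lerD2r; apply: ler_wpM2l; [exact: ltW|lra].
Qed.

(** * Examples and closure properties of absolutely continuous functions *)

Lemma lipschitz_real_ac a b f (L : R) :
  (forall x y, a <= x -> x <= y -> y <= b -> `|f y - f x| <= L * (y - x)) ->
  real_ac a b f.
Proof.
(* [L] may be zero or negative, so [|L| + 1] replaces it as a positive constant. *)
move=> fL e e0; have L0 : 0 < `|L| + 1 by rewrite ltr_wpDl.
exists (e / (`|L| + 1)); first exact: divr_gt0.
move=> n u v uv _; rewrite ltr_pdivlMr// mulrC => uve.
apply: le_lt_trans uve; rewrite mulr_sumr; apply: ler_sum => i _.
have [? ? ?] := uv i; rewrite (le_trans (fL _ _ _ _ _))//.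
by rewrite ler_wpM2r ?subr_ge0// (le_trans (ler_norm _))// lerDl.
Qed.

Lemma derivable_real_ac a b f df (L : R) :
  (forall x, is_derive x (1 : R) f (df x)) ->
  (forall x, a <= x <= b -> `|df x| <= L) -> real_ac a b f.
Proof.
move=> fdf dfL; apply: (@lipschitz_real_ac _ _ _ L) => x y ax xy yb.
have cf : {within `[x, y], continuous f}.
  by apply: derivable_within_continuous => c _; have [] := fdf c.
have [c cxy ->] := MVT_segment xy (fun c _ => fdf c) cf.
rewrite normrM [X in _ * X]ger0_norm ?subr_ge0// ler_wpM2r ?subr_ge0//.
by apply: dfL; move: cxy; rewrite in_itv/=; lra.
Qed.

Lemma real_ac_cst a b (k : R) : real_ac a b (fun=> k).
Proof.
by apply: (@lipschitz_real_ac _ _ _ 0) => *; rewrite subrr normr0 mul0r.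
Qed.

Lemma real_acB a b f g : real_ac a b f -> real_ac a b g ->
  real_ac a b (fun x => f x - g x).
Proof.
move=> acf acg e e0; have e20 : 0 < e / 2 by lra.
have [d d0 dP] := acf _ e20; have [d' d'0 d'P] := acg _ e20.
exists (Num.min d d'); first by rewrite lt_min d0.
move=> n u v uv tuv; rewrite lt_min.
move=> /andP[/(dP n u v uv tuv) fe /(d'P n u v uv tuv) ge].
rewrite (splitr e); apply: le_lt_trans (ltrD fe ge).
rewrite -big_split/=; apply: ler_sum => i _.
have -> : f (v i) - g (v i) - (f (u i) - g (u i)) =
  (f (v i) - f (u i)) - (g (v i) - g (u i)) by ring.
exact: ler_normB.
Qed.

Lemma real_acN a b f : real_ac a b f -> real_ac a b (fun x => - f x).
Proof.
move=> /(real_acB (real_ac_cst a b 0)); congr real_ac.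
by apply/funext => x; rewrite sub0r.
Qed.

Lemma real_acD a b f g : real_ac a b f -> real_ac a b g ->
  real_ac a b (fun x => f x + g x).
Proof.
move=> acf /real_acN/(real_acB acf); congr real_ac.
by apply/funext => x; rewrite opprK.
Qed.

Lemma within_continuous_bounded a b f : {within `[a, b], continuous f} ->
  exists2 M : R, 0 < M & forall x, a <= x <= b -> `|f x| <= M.
Proof.
move=> cf.
have /compact_bounded[M [_ MP]] := continuous_compact cf (@segment_compact _ a b).
exists (`|M| + 1); first by rewrite ltr_wpDl.
move=> x xab; apply: MP; first by rewrite (le_lt_trans (ler_norm _))// ltrDl.
by exists x => //=; rewrite in_itv.
Qed.

(** Both factors are bounded on the compact interval, and an increment of the product is
    [g v * (f v - f u) + f u * (g v - g u)]. The tolerances are weighted by these bounds so that the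
    two sums total [e]. *)
Lemma real_acM a b f g : a <= b -> real_ac a b f -> real_ac a b g ->
  real_ac a b (fun x => f x * g x).
Proof.
move=> ab acf acg e e0.
have [M M0 MP] := within_continuous_bounded (real_ac_continuous ab acf).
have [K K0 KP] := within_continuous_bounded (real_ac_continuous ab acg).
have [|d d0 dP] := acf (e / (2 * K)); first by rewrite divr_gt0 ?mulr_gt0.
have [|d' d'0 d'P] := acg (e / (2 * M)); first by rewrite divr_gt0 ?mulr_gt0.
exists (Num.min d d'); first by rewrite lt_min d0.
move=> n u v uv tuv; rewrite lt_min.
move=> /andP[/(dP n u v uv tuv) fe /(d'P n u v uv tuv) ge].
have -> : e = K * (e / (2 * K)) + M * (e / (2 * M)).
  by field; rewrite !gt_eqF.
have := ltrD (etrans (ltr_pM2l K0 _ _) fe) (etrans (ltr_pM2l M0 _ _) ge).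
apply: le_lt_trans.
rewrite !mulr_sumr -big_split/=; apply: ler_sum => i _.
have [? ? ?] := uv i.
have -> : f (v i) * g (v i) - f (u i) * g (u i) =
  g (v i) * (f (v i) - f (u i)) + f (u i) * (g (v i) - g (u i)) by ring.
rewrite (le_trans (ler_normD _ _))// !normrM.
apply: lerD; apply: ler_wpM2r => //; [apply: KP | apply: MP]; lra.
Qed.

(** * Primitives of integrable functions and the fundamental theorem of calculus *)

(** The integral of [|F|] over a set of small measure is small; this is applied to the union of the
    given disjoint intervals. *)
Lemma real_ac_integral a b F : mu.-integrable `[a, b] (EFin \o F) ->
  real_ac a b (fun x => \int[mu]_(s in `[a, x]) F s).
Proof.
move=> iF e e0.
(* Extension by zero makes the function integrable on the whole line. *)
pose Fab := F \_ `[a, b].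
have iFab : mu.-integrable setT (EFin \o Fab).
  by rewrite -restrict_EFin; apply/integrable_restrict => //=; rewrite setTI.
have [d [d0 dP]] := integral_normr_continuous iFab e0.
exists d => // n u v uv tuv uvd.
pose D := \big[setU/set0]_(i < n) `]u i, v i[%classic.
have mD : measurable D.
  by apply: bigsetU_measurable => i _; exact: measurable_itv.
have iFD : mu.-integrable D (EFin \o (fun x => `|Fab x|)).
  have iD : mu.-integrable D (EFin \o Fab) by apply: integrableS iFab.
  exact: (integrable_abse iD).
have muD : (mu D < d%:E)%E.
  have uv' i : u i <= v i by have [] := uv i.
  by have := measure_itv_bigsetU uv' tuv; rewrite -/D => ->; rewrite lte_fin.
have intD : ((\int[mu]_(x in D) `|Fab x|)%:E < e%:E)%E.
  by rewrite lte_fin; exact: dP mD muD.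
rewrite -lte_fin; apply: le_lt_trans intD.
rewrite /Rintegral fineK; last exact: integrable_fin_num.
rewrite /D ge0_integral_bigsetU//=; last 3 first.
- by apply: index_enum_uniq.
- by move=> i j _ _; exact: tuv.
- by case/integrableP : iFD.
rewrite -sumEFin; apply: lee_sum => i _.
have [aui uvi vb] := uv i.
have iF' (x : itv_bound R) y : (BLeft a <= x)%O -> y <= b ->
    mu.-integrable [set` Interval x (BRight y)] (EFin \o F).
  move=> ax yb; apply: integrableS iF => //.
  by apply: subset_itv; rewrite ?bnd_simp.
rewrite Rintegral_itvB ?bnd_simp//; last by apply: iF'; rewrite ?bnd_simp.
rewrite EFin_normr_Rintegral//; last by apply: iF'; rewrite ?bnd_simp.
(* The difference of two primitives is an integral over []u i, v i]], whereas the family consists of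
   open intervals; the endpoint is null. *)
rewrite -integral_itv_bndo_bndc; last first.
  have /integrableP[+ _] : mu.-integrable `]u i, v i] (EFin \o F).
    by apply: iF'; rewrite ?bnd_simp.
  by apply: measurable_funS => //; apply: subset_itv; rewrite ?bnd_simp.
apply: le_trans.
  apply: le_abse_integral => //.
  have /integrableP[+ _] : mu.-integrable `]u i, v i] (EFin \o F).
    by apply: iF'; rewrite ?bnd_simp.
  by apply: measurable_funS => //; apply: subset_itv; rewrite ?bnd_simp.
rewrite le_eqVlt; apply/orP; left; apply/eqP; apply: eq_integral => x.
rewrite inE/= in_itv/= => uxv; rewrite /Fab patchE mem_set//= in_itv/=; lra.
Qed.

(** Lebesgue differentiation applies to the extension of [F] by zero, whose primitive agrees with
    that of [F] near every interior point. *)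
Lemma integral_derive_ae a b F : mu.-integrable `[a, b] (EFin \o F) ->
  {ae mu, forall x, x \in `]a, b[ ->
    is_derive x (1 : R) (fun y => \int[mu]_(s in `[a, y]) F s) (F x)}.
Proof.
move=> iF; pose Fab := F \_ `[a, b].
have iFab : mu.-integrable setT (EFin \o Fab).
  by rewrite -restrict_EFin; apply/integrable_restrict => //=; rewrite setTI.
pose G x := \int[mu]_(s in `[a, x]) Fab s.
have iFaby y : mu.-integrable [set` Interval (BLeft a) (BRight y)] (EFin \o Fab).
  by apply: integrableS iFab.
have locF : locally_integrable setT Fab by apply: integrable_locally.
have := FTC1 iFaby locF.
apply: filterS; first exact: (ae_filter_ringOfSetsType mu).
move=> x dGx; rewrite in_itv/= => /andP[ax xb].
have [|dG dG'] := dGx; first by rewrite (@lte_fin R).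
have GF : {near x, G =1 (fun y => \int[mu]_(s in `[a, y]) F s)}.
  near=> y; apply: eq_Rintegral => z; rewrite inE/= in_itv/= => /andP[az zy].
  rewrite /Fab patchE mem_set//= in_itv/= az (le_trans zy)//.
  by apply: ltW; near: y; exact: lt_nbhsl.
apply: DeriveDef; first exact: near_eq_derivable dG.
rewrite -(near_eq_derive _ GF) -derive1E dG' /Fab patchE mem_set//=.
by rewrite in_itv/= !ltW.
Unshelve. all: by end_near. Qed.

(** The difference of [f] and the primitive of [F] is absolutely continuous with zero derivative
    almost everywhere, hence takes the same value at [a] and [t]. *)
Lemma real_ac_FTC a b f F : mu.-integrable `[a, b] (EFin \o F) ->
  real_ac a b f ->
  {ae mu, forall x, x \in `]a, b[ -> is_derive x (1 : R) f (F x)} ->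
  forall t, a <= t <= b -> f t = f a + \int[mu]_(s in `[a, t]) F s.
Proof.
move=> iF acf df t /andP[at_ tb].
pose G x := \int[mu]_(s in `[a, x]) F s.
have acG : real_ac a t G.
  apply: real_ac_integral; apply: integrableS iF => //.
  by apply: subset_itvl; rewrite bnd_simp.
have := @real_ac_derive0_end a t (fun x => f x - G x) at_.
have Ga : G a = 0 by rewrite /G set_itv1 Rintegral_set1.
rewrite /= Ga subr0 => <-; first by rewrite subrK.
  by apply: real_acB => //; exact: real_acS acf.
move: df (integral_derive_ae iF); apply: filterS2.
  exact: (ae_filter_ringOfSetsType mu).
move=> x dfx dGx xat.
have xab : x \in `]a, b[ by move: xat; rewrite !in_itv/=; lra.
have := is_deriveB (dfx xab) (dGx xab).
by rewrite subrr.
Qed.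

Lemma integrableM_continuous a b f g : mu.-integrable `[a, b] (EFin \o f) ->
  {within `[a, b], continuous g} ->
  mu.-integrable `[a, b] (EFin \o (fun x => f x * g x)).
Proof.
move=> fi cg; have [M M0 MP] := within_continuous_bounded cg.
have := @integrableMl _ _ _ mu `[a, b] _ (EFin \o f) g fi.
apply => //.
- exact: measurable_realfun.subspace_continuous_measurable_fun.
- exists M; split; first exact: num_real.
  move=> y My x /=; rewrite in_itv/= => xab.
  by rewrite (le_trans (MP _ xab))// ltW.
Qed.

Lemma real_acX a b f (n : nat) : a <= b -> real_ac a b f ->
  real_ac a b (fun x => f x ^+ n).
Proof.
move=> ab acf; elim: n => [|n IHn]; first exact: real_ac_cst.
under eq_fun do rewrite exprS.
exact: (real_acM ab acf IHn).
Qed.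

(** [W ^+ n.+1] is absolutely continuous with derivative [n.+1 * w * W ^+ n] almost everywhere. This
    is the source of the factorials in the estimates of iterated integrals. *)
Lemma integral_mul_pow a b w (n : nat) : a <= b ->
  mu.-integrable `[a, b] (EFin \o w) ->
  let W x := \int[mu]_(s in `[a, x]) w s in
  forall t, a <= t <= b ->
    \int[mu]_(s in `[a, t]) (w s * W s ^+ n) = W t ^+ n.+1 / n.+1%:R.
Proof.
move=> ab iw W t tab.
have acW : real_ac a b W by exact: real_ac_integral.
have acWn m : real_ac a b (fun x => W x ^+ m) by exact: real_acX.
have Wa : W a = 0 by rewrite /W set_itv1 Rintegral_set1.
have n0 : n.+1%:R != 0 :> R by rewrite pnatr_eq0.
have := @real_ac_FTC a b (fun x => W x ^+ n.+1)
  (fun x => n.+1%:R * (w x * W x ^+ n)).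
have iwW : mu.-integrable `[a, b] (EFin \o (fun x => w x * W x ^+ n)).
  by apply: integrableM_continuous => //; exact: real_ac_continuous.
move=> /(_ _ (acWn _) _ _ tab) ->; last 2 first.
- exact: integrableZl iwW.
- have := integral_derive_ae iw; apply: filterS.
    exact: (ae_filter_ringOfSetsType mu).
  move=> x dWx xab.
  have := is_deriveX n.+1 (dWx xab); rewrite exprfctE.
  have -> // : (n.+1%:R * W x ^+ n) *: w x = n.+1%:R * (w x * W x ^+ n).
  by rewrite /GRing.scale/=; ring.
rewrite Wa expr0n add0r RintegralZl//; last first.
  by apply: integrableS iwW => //; apply: subset_itvl; rewrite bnd_simp; case/andP: tab.
by rewrite mulrAC mulfV// mul1r.
Qed.

End AbsoluteContinuity.

(** * Integration of complex-valued functions *)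

Section ComplexCalculus.
Variable R : realType.
Implicit Types (z c : R[i]) (f g F : R -> R[i]) (t T : R).
Notation mu := (@lebesgue_measure R).
Notation Re := (@complex.Re R).
Notation Im := (@complex.Im R).
Local Open Scope complex_scope.

(* Integrating componentwise, this norm satisfies the triangle inequality for
   integrals at once; it dominates the modulus. *)
Definition norm1c z : R := `|Re z| + `|Im z|.

Lemma norm1c_ge0 z : 0 <= norm1c z. Proof. exact: addr_ge0. Qed.

Lemma norm1cM z w : norm1c (z * w) <= norm1c z * norm1c w.
Proof.
case: z w => [a b] [c d]; rewrite /norm1c /=.
rewrite (le_trans (lerD (ler_normB _ _) (ler_normD _ _)))// !normrM.
by rewrite le_eqVlt; apply/orP; left; apply/eqP; ring.
Qed.

Lemma normc_le_norm1c z : Normc.normc z <= norm1c z.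
Proof.
case: z => a b; rewrite /norm1c /=.
rewrite -[leRHS]ger0_norm ?addr_ge0// -sqrtr_sqr ler_wsqrtr//.
by rewrite sqrrD !real_normK ?num_real// addrAC lerDl mulrn_wge0// mulr_ge0.
Qed.

Lemma Re_le_normc z : `|Re z| <= Normc.normc z.
Proof.
by case: z => a b /=; rewrite -sqrtr_sqr ler_wsqrtr// lerDl sqr_ge0.
Qed.

Lemma Im_le_normc z : `|Im z| <= Normc.normc z.
Proof.
by case: z => a b /=; rewrite -sqrtr_sqr ler_wsqrtr// lerDr sqr_ge0.
Qed.

Lemma ReM z w : Re (z * w) = Re z * Re w - Im z * Im w.
Proof. by case: z w => [a b] [c d]. Qed.
Lemma ImM z w : Im (z * w) = Re z * Im w + Im z * Re w.
Proof. by case: z w => [a b] [c d]. Qed.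
Lemma ReB z w : Re (z - w) = Re z - Re w.
Proof. by case: z w => [a b] [c d]. Qed.
Lemma ImB z w : Im (z - w) = Im z - Im w.
Proof. by case: z w => [a b] [c d]. Qed.
Lemma ReD z w : Re (z + w) = Re z + Re w.
Proof. by case: z w => [a b] [c d]. Qed.
Lemma ImD z w : Im (z + w) = Im z + Im w.
Proof. by case: z w => [a b] [c d]. Qed.

Lemma complex_eqP z w : Re z = Re w -> Im z = Im w -> z = w.
Proof. by case: z w => [a b] [c d] /= -> ->. Qed.

Definition ccontinuous T f :=
  {within `[0, T], continuous (fun x => Re (f x))} /\
  {within `[0, T], continuous (fun x => Im (f x))}.

Lemma ccontinuous_bounded T f : ccontinuous T f ->
  exists2 M : R, 0 <= M & forall t, 0 <= t <= T -> norm1c (f t) <= M.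
Proof.
move=> [/within_continuous_bounded[M M0 MP] /within_continuous_bounded[K K0 KP]].
exists (M + K); first by rewrite addr_ge0// ltW.
by move=> t tT; apply: lerD; [exact: MP | exact: KP].
Qed.

Lemma ccontinuous_cst T c : ccontinuous T (fun=> c).
Proof. by split; apply: continuous_subspaceT => x; exact: cvg_cst. Qed.

Lemma cintegrableS (A B : set (measurableTypeR R)) f : measurable A -> measurable B ->
  B `<=` A -> cintegrable A f -> cintegrable B f.
Proof.
by move=> mA mB BA [fr fi]; split;
  [apply: integrableS fr | apply: integrableS fi].
Qed.

Lemma cintegrable_cc T t f : 0 <= t <= T ->
  cintegrable `[0, T] f -> cintegrable `[0, t] f.
Proof.
move=> /andP[_ tT]; apply: cintegrableS => //.
by apply: subset_itvl; rewrite bnd_simp.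
Qed.

Lemma cintegrableM T f g : cintegrable `[0, T] f -> ccontinuous T g ->
  cintegrable `[0, T] (fun s => f s * g s).
Proof.
move=> [fr fi] [gr gi]; split.
- have -> : (fun s => (Re (f s * g s))%:E) =
      (fun s => ((Re (f s) * Re (g s))%:E - (Im (f s) * Im (g s))%:E)%E).
    by apply/funext => s; rewrite ReM.
  by apply: integrableB => //; exact: integrableM_continuous.
- have -> : (fun s => (Im (f s * g s))%:E) =
      (fun s => ((Re (f s) * Im (g s))%:E + (Im (f s) * Re (g s))%:E)%E).
    by apply/funext => s; rewrite ImM.
  by apply: integrableD => //; exact: integrableM_continuous.
Qed.

Lemma cintegrableMl T c f : cintegrable `[0, T] f ->
  cintegrable `[0, T] (fun s => c * f s).
Proof.
move=> fi; have -> : (fun s => c * f s) = (fun s => f s * c).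
  by apply/funext => s; rewrite mulrC.
by apply: cintegrableM => //; exact: ccontinuous_cst.
Qed.

Lemma cintegralB (A : set (measurableTypeR R)) f g : measurable A ->
  cintegrable A f -> cintegrable A g ->
  cintegral A (fun s => f s - g s) = cintegral A f - cintegral A g.
Proof.
move=> mA [fr fi] [gr gi]; apply: complex_eqP => /=.
- by under eq_Rintegral do rewrite ReB; rewrite RintegralB.
- by under eq_Rintegral do rewrite ImB; rewrite RintegralB.
Qed.

Lemma cintegralMl (A : set (measurableTypeR R)) c f : measurable A -> cintegrable A f ->
  cintegral A (fun s => c * f s) = c * cintegral A f.
Proof.
move=> mA [fr fi]; have iZ (k : R) (h : R -> R) : mu.-integrable A (EFin \o h) ->
  mu.-integrable A (EFin \o (fun x => k * h x)) by move=> ih; exact: integrableZl ih.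
apply: complex_eqP; rewrite ?ReM ?ImM /=.
- transitivity (\int[mu]_(s in A) (Re c * Re (f s) - Im c * Im (f s))).
    by apply: eq_Rintegral => s _; rewrite ReM.
  by rewrite RintegralB ?RintegralZl//; exact: iZ.
- transitivity (\int[mu]_(s in A) (Re c * Im (f s) + Im c * Re (f s))).
    by apply: eq_Rintegral => s _; rewrite ImM.
  by rewrite RintegralD ?RintegralZl//; exact: iZ.
Qed.

Lemma cintegral_continuous T f : 0 <= T -> cintegrable `[0, T] f ->
  ccontinuous T (fun t => cintegral `[0, t] f).
Proof. by move=> T0 [fr fi]; split; exact: parameterized_integral_continuous. Qed.

Lemma integrable_norm1c (A : set (measurableTypeR R)) f : measurable A -> cintegrable A f ->
  mu.-integrable A (EFin \o (norm1c \o f)).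
Proof.
move=> mA [fr fi].
exact: (integrableD mA (integrable_abse fr) (integrable_abse fi)).
Qed.

Lemma norm1c_cintegral (A : set (measurableTypeR R)) f : measurable A -> cintegrable A f ->
  norm1c (cintegral A f) <= \int[mu]_(x in A) norm1c (f x).
Proof.
move=> mA [fr fi]; rewrite /norm1c RintegralD//.
- by apply: lerD; exact: le_normr_Rintegral.
- exact: integrable_abse fr.
- exact: integrable_abse fi.
Qed.

End ComplexCalculus.

(** * Iterated integrals *)

Section IteratedIntegrals.
Variable R : realType.
Variable T : R.
Hypothesis T0 : 0 <= T.
Implicit Types (z c : R[i]) (f g a b u v : R -> R[i]) (t : R).
Notation mu := (@lebesgue_measure R).
Notation Re := (@complex.Re R).
Notation Im := (@complex.Im R).

Lemma ccontinuousB f g : ccontinuous T f -> ccontinuous T g ->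
  ccontinuous T (fun t => f t - g t).
Proof.
move=> [fr fi] [gr gi]; split.
- have -> : (fun x => Re (f x - g x)) = (fun x => Re (f x) - Re (g x)).
    by apply/funext => x; rewrite ReB.
  by move=> x; apply: cvgB; [exact: fr | exact: gr].
- have -> : (fun x => Im (f x - g x)) = (fun x => Im (f x) - Im (g x)).
    by apply/funext => x; rewrite ImB.
  by move=> x; apply: cvgB; [exact: fi | exact: gi].
Qed.

Lemma ccontinuousMl c f : ccontinuous T f -> ccontinuous T (fun t => c * f t).
Proof.
move=> [fr fi]; split.
- have -> : (fun x => Re (c * f x)) = (fun x => Re c * Re (f x) - Im c * Im (f x)).
    by apply/funext => x; rewrite ReM.
  by move=> x; apply: cvgB; apply: cvgMr; [exact: fr | exact: fi].
- have -> : (fun x => Im (c * f x)) = (fun x => Re c * Im (f x) + Im c * Re (f x)).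
    by apply/funext => x; rewrite ImM.
  by move=> x; apply: cvgD; apply: cvgMr; [exact: fi | exact: fr].
Qed.

Lemma alt_integral_ccontinuous m a b :
  cintegrable `[0, T] a -> cintegrable `[0, T] b ->
  ccontinuous T (alt_integral a b m).
Proof.
elim: m a b => [|m IHm] a b ia ib /=; first exact: ccontinuous_cst.
by apply: cintegral_continuous => //; apply: cintegrableM => //; exact: IHm.
Qed.

(** The remainders of the series have this shape; [d] is left arbitrary because their coefficients
    depend on the parity of the index. *)
Lemma ccontinuous_sub_sum n (d : nat -> R[i]) (F : nat -> R -> R[i]) v :
  (forall k, ccontinuous T (F k)) -> ccontinuous T v ->
  ccontinuous T (fun s => v s - \sum_(0 <= k < n) d k * F k s).
Proof.
move=> cF cv; elim: n => [|n IHn].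
  by have -> : (fun s => v s - \sum_(0 <= k < 0) d k * F k s) = v
    by apply/funext => s; rewrite big_nil subr0.
have -> : (fun s => v s - \sum_(0 <= k < n.+1) d k * F k s) =
    (fun s => v s - \sum_(0 <= k < n) d k * F k s - d n * F n s).
  by apply/funext => s; rewrite big_nat_recr//= opprD addrA.
by apply: ccontinuousB => //; exact: ccontinuousMl.
Qed.

Lemma cintegral_sub_sum n (d : nat -> R[i]) (F : nat -> R -> R[i]) a v t :
  cintegrable `[0, T] a -> (forall k, ccontinuous T (F k)) -> ccontinuous T v ->
  0 <= t <= T ->
  cintegral `[0, t] (fun s => a s * (v s - \sum_(0 <= k < n) d k * F k s)) =
  cintegral `[0, t] (fun s => a s * v s) -
    \sum_(0 <= k < n) d k * cintegral `[0, t] (fun s => a s * F k s).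
Proof.
move=> ia cF cv tT; elim: n => [|n IHn].
  rewrite big_nil subr0; congr cintegral.
  by apply/funext => s; rewrite big_nil subr0.
rewrite big_nat_recr//= opprD addrA -IHn -cintegralMl//; last first.
  by apply: cintegrable_cc tT _; exact: cintegrableM.
rewrite -cintegralB//.
- by congr cintegral; apply/funext => s; rewrite big_nat_recr//=; ring.
- by apply: cintegrable_cc tT _; apply: cintegrableM => //; exact: ccontinuous_sub_sum.
- by apply: cintegrable_cc tT _; apply: cintegrableMl; exact: cintegrableM.
Qed.

Variable w : R -> R.
Hypothesis iw : mu.-integrable `[0, T] (EFin \o w).
(** [w] is to majorize both weights at once, so that bounds through its primitive are unaffected by
    exchanging [a] and [b]. *)
Let W t := \int[mu]_(s in `[0, t]) w s.

(** One more integration raises the order of the bound by one, since [W ^+ m / m!] integrates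
    against [w] to [W ^+ m.+1 / m.+1!]. *)
Lemma norm1c_cintegral_le a f m (M : R) : cintegrable `[0, T] a ->
  (forall s, 0 <= s <= T -> norm1c (a s) <= w s) ->
  ccontinuous T f ->
  (forall s, 0 <= s <= T -> norm1c (f s) <= M * (W s ^+ m / m`!%:R)) ->
  forall t, 0 <= t <= T ->
  norm1c (cintegral `[0, t] (fun s => a s * f s)) <=
    M * (W t ^+ m.+1 / m.+1`!%:R).
Proof.
move=> ia aw cf fM t tT.
have iaf := cintegrable_cc tT (cintegrableM ia cf).
have m0 : m`!%:R != 0 :> R by rewrite pnatr_eq0 -lt0n fact_gt0.
have m1 : m.+1%:R != 0 :> R by rewrite pnatr_eq0.
have iwW : mu.-integrable `[0, T] (EFin \o (fun s => w s * W s ^+ m)).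
  apply: integrableM_continuous => //; apply: real_ac_continuous => //.
  by apply: real_acX => //; exact: real_ac_integral.
have iwWt : mu.-integrable `[0, t] (EFin \o (fun s => w s * W s ^+ m)).
  apply: integrableS iwW => //.
  by apply: subset_itvl; rewrite bnd_simp; case/andP: tT.
apply: (le_trans (norm1c_cintegral _ iaf)) => //.
(* Writing the target as an integral reduces the claim to a pointwise comparison of integrands. *)
have -> : M * (W t ^+ m.+1 / m.+1`!%:R) =
    \int[mu]_(s in `[0, t]) (M / m`!%:R * (w s * W s ^+ m)).
  rewrite RintegralZl// (integral_mul_pow _ T0 iw tT) -/(W t) factS natrM.
  by field; rewrite m0 nat1r m1.
apply: le_Rintegral => //.
- exact: integrable_norm1c.
- exact: integrableZl iwWt.
move=> s /=; rewrite in_itv/= => st.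
have sT : 0 <= s <= T by lra.
rewrite (le_trans (norm1cM _ _))//.
have := ler_pM (norm1c_ge0 _) (norm1c_ge0 _) (aw _ sT) (fM _ sT).
by congr (_ <= _); ring.
Qed.

(** Induction on [m] with [a] and [b] general, as each layer exchanges them; every layer is an
    instance of the previous estimate with [M = 1]. *)
Lemma norm1c_alt_integral m a b : cintegrable `[0, T] a -> cintegrable `[0, T] b ->
  (forall s, 0 <= s <= T -> norm1c (a s) <= w s) ->
  (forall s, 0 <= s <= T -> norm1c (b s) <= w s) ->
  forall t, 0 <= t <= T -> norm1c (alt_integral a b m t) <= W t ^+ m / m`!%:R.
Proof.
elim: m a b => [|m IHm] a b ia ib aw bw t tT.
  by rewrite expr0 fact0 divr1 /alt_integral /norm1c /= normr1 normr0 addr0.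
rewrite -[leRHS]mul1r; apply: norm1c_cintegral_le => //.
  exact: alt_integral_ccontinuous.
by move=> s sT; rewrite mul1r; exact: IHm.
Qed.

(* Since al * be = 1, integrating the remainder of order m of v against al * a
   gives the remainder of order m + 1 of u. *)
Lemma system_remainder m a b u v (u0 v0 al be : R[i]) (M : R) :
  cintegrable `[0, T] a -> cintegrable `[0, T] b ->
  (forall s, 0 <= s <= T -> norm1c (a s) <= w s) ->
  (forall s, 0 <= s <= T -> norm1c (b s) <= w s) ->
  ccontinuous T u -> ccontinuous T v ->
  (forall s, 0 <= s <= T -> norm1c (u s) <= M) ->
  (forall s, 0 <= s <= T -> norm1c (v s) <= M) ->
  al * be = 1 -> norm1c al <= 1 -> norm1c be <= 1 ->
  (forall t, 0 <= t <= T -> u t = u0 + al * cintegral `[0, t] (fun s => a s * v s)) ->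
  (forall t, 0 <= t <= T -> v t = v0 + be * cintegral `[0, t] (fun s => b s * u s)) ->
  let S t := \sum_(0 <= k < m) (if odd k then al * v0 else u0) * alt_integral a b k t in
  forall t, 0 <= t <= T -> norm1c (u t - S t) <= M * (W t ^+ m / m`!%:R).
Proof.
elim: m a b u v u0 v0 al be => [|m IHm] a b u v u0 v0 al be
  ia ib aw bw cu cv uM vM albe al1 be1 uE vE S t tT.
  by rewrite /S big_nil subr0 expr0 fact0 divr1 mulr1 uM.
have beal : be * al = 1 by rewrite mulrC.
(* The induction hypothesis for the system with the two equations exchanged estimates the remainder
   of [v]. *)
have RM := IHm b a v u v0 u0 be al ib ia bw aw cv cu vM uM beal be1 al1 vE uE.
pose d k := if odd k then be * u0 else v0.
have cF k : ccontinuous T (alt_integral b a k) by exact: alt_integral_ccontinuous.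
have -> : u t - S t = al * cintegral `[0, t]
    (fun s => a s * (v s - \sum_(0 <= k < m) d k * alt_integral b a k s)).
  rewrite cintegral_sub_sum// uE// /S big_nat_recl//= mulr1 mulrBr mulr_sumr.
  rewrite opprD addrACA subrr add0r; congr (_ - _); apply: eq_bigr => k _.
  (* The free term of [u] has cancelled against index 0 of the sum; it remains to see that
     multiplication by [al] turns the coefficient of [v] at [k] into that of [u] at [k.+1], where
     [al * be = 1] settles odd [k]. *)
  rewrite mulrA; congr (_ * _); rewrite /d; case: (odd k) => //=.
  by rewrite mulrA albe mul1r.
rewrite (le_trans (norm1cM _ _))//.
have := norm1c_cintegral_le ia aw (ccontinuous_sub_sum _ _ _ _) RM tT.
move=> /(_ cF cv) H; apply: le_trans H.
by rewrite ler_piMl// norm1c_ge0.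
Qed.

End IteratedIntegrals.

(** * Differentiation of complex-valued functions *)

Section ComplexDerivatives.
Variable R : realType.
Implicit Types (z c d : R[i]) (f g F : R -> R[i]) (x t T : R).
Notation mu := (@lebesgue_measure R).
Notation Re := (@complex.Re R).
Notation Im := (@complex.Im R).

(** The endpoints are null. [P] and [Q] are integrable on the open interval, while the iterated
    integrals run over closed ones. *)
Lemma cintegrable_itv_cc x y f : cintegrable `]x, y[ f -> cintegrable `[x, y] f.
Proof.
have cc (h : R -> R) : mu.-integrable `]x, y[ (EFin \o h) -> mu.-integrable `[x, y] (EFin \o h).
  move=> ih; have /integrableP[mh hoo] := ih.
  have /integrableP[mah _] := integrable_abse ih.
  apply/integrableP; split.
    exact: measurable_realfun.emeasurable_fun_itv_cc mh.
  by rewrite integral_itv_bndoo.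
by move=> [fr fi]; split; exact: cc.
Qed.

Lemma cexpD z w : cexp (z + w) = cexp z * cexp w.
Proof.
by rewrite /cexp ReD ImD expRD cosD sinD; apply: complex_eqP;
  rewrite ?ReM ?ImM /=; ring.
Qed.

Lemma cexp0 : cexp (0 : R[i]) = 1.
Proof. by apply: complex_eqP; rewrite /= expR0 ?cos0 ?sin0; ring. Qed.

Lemma cexpN_mul z : cexp (- z) * cexp z = 1.
Proof. by rewrite -cexpD addNr cexp0. Qed.

(** As a relation, it carries differentiability and the value together through the product and chain
    rules. *)
Definition is_cderive f x d :=
  is_derive x (1 : R) (fun s => Re (f s)) (Re d) /\
  is_derive x (1 : R) (fun s => Im (f s)) (Im d).

Lemma cderivable_is_cderive f x : cderivable f x -> is_cderive f x (cderive f x).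
Proof.
by move=> [fr fi]; split; apply: DeriveDef => //=; rewrite derive1E.
Qed.

Lemma is_cderiveM f g x df dg : is_cderive f x df -> is_cderive g x dg ->
  is_cderive (fun s => f s * g s) x (df * g x + f x * dg).
Proof.
move=> [fr fi] [gr gi]; split.
- have -> : (fun s => Re (f s * g s)) =
      (fun s => Re (f s) * Re (g s) - Im (f s) * Im (g s)).
    by apply/funext => s; rewrite ReM.
  have h := is_deriveB (is_deriveM fr gr) (is_deriveM fi gi).
  apply: (is_derive_eq h).
  by rewrite ReD !ReM /GRing.scale/=; ring.
- have -> : (fun s => Im (f s * g s)) =
      (fun s => Re (f s) * Im (g s) + Im (f s) * Re (g s)).
    by apply/funext => s; rewrite ImM.
  have h := is_deriveD (is_deriveM fr gi) (is_deriveM fi gr).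
  apply: (is_derive_eq h).
  by rewrite ImD !ImM /GRing.scale/=; ring.
Qed.

Lemma is_derive_mull (k x : R) : is_derive x (1 : R) (fun s => k * s) k.
Proof.
have := is_deriveZ k (is_derive_id x (1 : R)).
by rewrite /GRing.scale/= mulr1.
Qed.

(** The exponent has parts [Re c * s] and [Im c * s], so the real chain rule for [expR], [cos] and
    [sin] suffices. *)
Lemma is_cderive_cexp c x :
  is_cderive (fun s => cexp (c * s%:C%C)) x (c * cexp (c * x%:C%C)).
Proof.
have ReE s : Re (c * s%:C%C) = Re c * s by rewrite ReM /= mulr0 subr0.
have ImE s : Im (c * s%:C%C) = Im c * s by rewrite ImM /= mulr0 add0r.
have dE := is_derive1_comp (is_derive_expR (Re c * x)) (is_derive_mull (Re c) x).
have dC := is_derive1_comp (is_derive_cos (Im c * x)) (is_derive_mull (Im c) x).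
have dS := is_derive1_comp (is_derive_sin (Im c * x)) (is_derive_mull (Im c) x).
split.
- have -> : (fun s => Re (cexp (c * s%:C%C))) =
      (fun s => expR (Re c * s) * cos (Im c * s)).
    by apply/funext => s; rewrite /cexp /= ReE ImE.
  apply: (is_derive_eq (is_deriveM dE dC)).
  by rewrite ReM /cexp ReE ImE /GRing.scale/=; ring.
- have -> : (fun s => Im (cexp (c * s%:C%C))) =
      (fun s => expR (Re c * s) * sin (Im c * s)).
    by apply/funext => s; rewrite /cexp /= ReE ImE.
  apply: (is_derive_eq (is_deriveM dE dS)).
  by rewrite ImM /cexp ReE ImE /GRing.scale/=; ring.
Qed.

Definition cac T f :=
  real_ac 0 T (fun x => Re (f x)) /\ real_ac 0 T (fun x => Im (f x)).

Lemma abs_continuous_cac T f : abs_continuous 0 T f -> cac T f.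
Proof.
move=> acf; split=> e /acf[d d0 dP]; exists d => // n u v uv tuv uvd;
  apply: le_lt_trans (dP n u v uv tuv uvd); apply: ler_sum => i _.
- by rewrite -ReB Re_le_normc.
- by rewrite -ImB Im_le_normc.
Qed.

Lemma cac_ccontinuous T f : 0 <= T -> cac T f -> ccontinuous T f.
Proof. by move=> T0 [fr fi]; split; exact: real_ac_continuous. Qed.

Lemma cacM T f g : 0 <= T -> cac T f -> cac T g -> cac T (fun x => f x * g x).
Proof.
move=> T0 [fr fi] [gr gi]; split.
- have -> : (fun s => Re (f s * g s)) =
      (fun s => Re (f s) * Re (g s) - Im (f s) * Im (g s)).
    by apply/funext => s; rewrite ReM.
  exact: (real_acB (real_acM T0 fr gr) (real_acM T0 fi gi)).
- have -> : (fun s => Im (f s * g s)) =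
      (fun s => Re (f s) * Im (g s) + Im (f s) * Re (g s)).
    by apply/funext => s; rewrite ImM.
  exact: (real_acD (real_acM T0 fr gi) (real_acM T0 fi gr)).
Qed.

Lemma is_cderive_ccontinuous T f df : (forall x, is_cderive f x (df x)) ->
  ccontinuous T f.
Proof.
by move=> fdf; split; apply: derivable_within_continuous => x _;
  have [[? _] [? _]] := fdf x.
Qed.

(** The derivative is continuous, hence bounded on [[0, T]], and the mean value theorem makes both
    parts Lipschitz. *)
Lemma cexp_cac T c : cac T (fun s => cexp (c * s%:C%C)).
Proof.
have dc := is_cderive_cexp c.
have [M M0 MP] := ccontinuous_bounded (ccontinuousMl c (is_cderive_ccontinuous T dc)).
split.
- apply: (@derivable_real_ac _ _ _ _ (fun x => Re (c * cexp (c * x%:C%C))) M).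
    by move=> x; have [] := dc x.
  by move=> x /MP; apply: le_trans; rewrite lerDl.
- apply: (@derivable_real_ac _ _ _ _ (fun x => Im (c * cexp (c * x%:C%C))) M).
    by move=> x; have [] := dc x.
  by move=> x /MP; apply: le_trans; rewrite lerDr.
Qed.

Lemma cac_FTC T f F : cintegrable `[0, T] F -> cac T f ->
  {ae mu, forall x, x \in `]0, T[ -> is_cderive f x (F x)} ->
  forall t, 0 <= t <= T -> f t = f 0 + cintegral `[0, t] F.
Proof.
move=> [Fr Fi] [fr fi] df t tT; apply: complex_eqP; rewrite ?ReD ?ImD.
- apply: (real_ac_FTC Fr fr) tT; move: df; apply: filterS.
    exact: (ae_filter_ringOfSetsType mu).
  by move=> x dx /dx[].
- apply: (real_ac_FTC Fi fi) tT; move: df; apply: filterS.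
    exact: (ae_filter_ringOfSetsType mu).
  by move=> x dx /dx[].
Qed.

End ComplexDerivatives.

(** * The Dirac system as a pair of integral equations *)

Section DiracIntegralEquations.
Variable R : realType.
Variables (P Q : R -> R[i]) (lambda : R[i]) (y : R -> 'cV[R[i]]_2).
Hypothesis hP : cintegrable `]0, pi[ P.
Hypothesis hQ : cintegrable `]0, pi[ Q.
Hypothesis hy : dirac_solution P Q lambda y.
Notation mu := (@lebesgue_measure R).

Let u t := cexp (- ('i%C * lambda * t%:C%C)) * y t 0 0.
Let v t := cexp ('i%C * lambda * t%:C%C) * y t 1 0.

Lemma wP_cintegrable : cintegrable `[0, pi] (wP P lambda).
Proof.
rewrite /wP; have -> : (fun s => cexp (- (2 * 'i%C * lambda * s%:C%C)) * P s) =
    (fun s => P s * cexp (- (2 * 'i%C * lambda) * s%:C%C)).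
  by apply/funext => s; rewrite mulrC mulNr.
apply: cintegrableM; first exact: cintegrable_itv_cc.
exact: is_cderive_ccontinuous (is_cderive_cexp _).
Qed.

Lemma wQ_cintegrable : cintegrable `[0, pi] (wQ Q lambda).
Proof.
rewrite /wQ; have -> : (fun s => cexp (2 * 'i%C * lambda * s%:C%C) * Q s) =
    (fun s => Q s * cexp (2 * 'i%C * lambda * s%:C%C)).
  by apply/funext => s; rewrite mulrC.
apply: cintegrableM; first exact: cintegrable_itv_cc.
exact: is_cderive_ccontinuous (is_cderive_cexp _).
Qed.

Lemma dirac_cac : cac pi u /\ cac pi v.
Proof.
have [acy _] := hy; split; apply: cacM; rewrite ?pi_ge0//.
- under eq_fun do rewrite -mulNr.
  exact: cexp_cac.
- by apply: abs_continuous_cac; exact: acy.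
- exact: cexp_cac.
- by apply: abs_continuous_cac; exact: acy.
Qed.

(** The rows of the system are solved for the derivatives by multiplying the first by ['i] and the
    second by [- 'i]. *)
Lemma dirac_equations x :
  dirac_B R *m (\col_j cderive (fun s => y s j 0) x) + dirac_V P Q x *m y x
    = lambda *: y x ->
  cderive (fun s => y s 0 0) x = 'i%C * lambda * y x 0 0 - 'i%C * P x * y x 1 0 /\
  cderive (fun s => y s 1 0) x = - 'i%C * lambda * y x 1 0 + 'i%C * Q x * y x 0 0.
Proof.
move=> H; have ii : 'i%C * 'i%C = -1 :> R[i] by rewrite -expr2 sqr_i.
have := congr1 (fun M : 'cV__ => M 0 0) H.
have := congr1 (fun M : 'cV__ => M 1 0) H.
rewrite !mxE !big_ord_recl !big_ord0 !mxE/= !mul0r !addr0 !add0r => H1 H0.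
have l1 : lift ord0 ord0 = 1 :> 'I_2 by exact: val_inj.
move: H0 H1; rewrite l1; set A := cderive _ x; set C := cderive _ x => H0 H1.
split.
(* [ring] does not know that the square of ['i] is [-1], so this factor is inserted by hand. *)
- have -> : A = - ('i%C * 'i%C) * A by rewrite ii opprK mul1r.
  have -> : - ('i%C * 'i%C) * A =
    'i%C * (- 'i%C * A + P x * y x 1 0) - 'i%C * P x * y x 1 0 by ring.
  by rewrite H0; ring.
- have -> : C = - ('i%C * 'i%C) * C by rewrite ii opprK mul1r.
  have -> : - ('i%C * 'i%C) * C =
    - 'i%C * ('i%C * C + Q x * y x 0 0) + 'i%C * Q x * y x 0 0 by ring.
  by rewrite H1; ring.
Qed.

(** In the product rule the derivative of the exponential factor cancels the [lambda] term of the
    equation, leaving only the coupling term to integrate. *)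
Lemma dirac_integral_equations :
  (forall t, 0 <= t <= pi ->
    u t = u 0 + - 'i%C * cintegral `[0, t] (fun s => wP P lambda s * v s)) /\
  (forall t, 0 <= t <= pi ->
    v t = v 0 + 'i%C * cintegral `[0, t] (fun s => wQ Q lambda s * u s)).
Proof.
have [acu acv] := dirac_cac.
have [_ ode] := hy.
have iwv : cintegrable `[0, pi] (fun s => wP P lambda s * v s).
  by apply: cintegrableM wP_cintegrable (cac_ccontinuous (pi_ge0 R) acv).
have iwu : cintegrable `[0, pi] (fun s => wQ Q lambda s * u s).
  by apply: cintegrableM wQ_cintegrable (cac_ccontinuous (pi_ge0 R) acu).
(* The exponents [-2 i lambda x] of the weight and [i lambda x] of [v] combine to that of [u];
   symmetrically for [wQ] below. *)
have wPv x : wP P lambda x * v x =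
    cexp (- ('i%C * lambda * x%:C%C)) * (P x * y x 1 0).
  have -> : - ('i%C * lambda * x%:C%C) =
    - (2 * 'i%C * lambda * x%:C%C) + 'i%C * lambda * x%:C%C by ring.
  by rewrite cexpD /wP /v; ring.
have wQu x : wQ Q lambda x * u x =
    cexp ('i%C * lambda * x%:C%C) * (Q x * y x 0 0).
  have -> : 'i%C * lambda * x%:C%C =
    2 * 'i%C * lambda * x%:C%C + - ('i%C * lambda * x%:C%C) by ring.
  by rewrite cexpD /wQ /u; ring.
split=> t tpi.
- rewrite -cintegralMl//; last exact: cintegrable_cc tpi iwv.
  apply: cac_FTC tpi => //; first exact: cintegrableMl.
  move: ode; apply: filterS.
    exact: (ae_filter_ringOfSetsType mu).
  move=> x yx xpi; have [dy /dirac_equations[y0 _]] := yx xpi.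
  have := is_cderiveM (is_cderive_cexp (- ('i%C * lambda)) x)
                      (cderivable_is_cderive (dy 0)).
  rewrite y0 wPv (mulNr _ x%:C%C).
  have -> : (fun s => cexp (- ('i%C * lambda) * s%:C%C) * y s 0 0) = u.
    by apply/funext => s; rewrite /u mulNr.
  by congr is_cderive; ring.
- rewrite -cintegralMl//; last exact: cintegrable_cc tpi iwu.
  apply: cac_FTC tpi => //; first exact: cintegrableMl.
  move: ode; apply: filterS.
    exact: (ae_filter_ringOfSetsType mu).
  move=> x yx xpi; have [dy /dirac_equations[_ y1]] := yx xpi.
  have := is_cderiveM (is_cderive_cexp ('i%C * lambda) x)
                      (cderivable_is_cderive (dy 1)).
  rewrite y1 wQu.
  by congr is_cderive; ring.
Qed.

End DiracIntegralEquations.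

(** * Summation of the series *)

Section UniformSums.
Variable R : realType.
Implicit Types (D : set R) (F : nat -> R -> R[i]) (l : R -> R[i]) (eps : R^nat).
Notation mu := (@lebesgue_measure R).

Lemma csum_eq (a : nat -> R[i]) (s : R[i]) eps : eps @ \oo --> (0 : R) ->
  (forall N, Normc.normc (s - \sum_(0 <= n < N) a n) <= eps N) -> csum a = s.
Proof.
move=> eps0 aeps; rewrite /csum; apply: (cvg_lim (@norm_hausdorff _ R[i]^o)).
(* A positive element of [R[i]] is real, so its real part serves as the tolerance for [eps]. *)
apply/cvgrPdist_lt => e; rewrite ltcE => /andP[/eqP ime ree].
have /cvgrPdist_lt/(_ _ ree) := eps0.
apply: filterS => N; rewrite sub0r normrN => epsN.
rewrite ltcE /= ime eqxx/=; apply: le_lt_trans (aeps N) _.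
by apply: le_lt_trans epsN; exact: ler_norm.
Qed.

(** The bound identifies each sum as [l t], and being independent of [t] it also gives uniform
    convergence. *)
Lemma uniform_csum D F l eps : eps @ \oo --> (0 : R) ->
  (forall N t, D t -> Normc.normc (l t - \sum_(0 <= n < N) F n t) <= eps N) ->
  {uniform D, (fun n t => series (fun k => F k t : R[i]^o) n) @ \oo -->
              (fun t => csum (fun k => F k t) : R[i]^o)}.
Proof.
move=> eps0 Feps S /uniform_nbhs[E [/= entE ES]].
have [e e0 eE] : exists2 e : R[i], 0 < e & forall x y : R[i]^o, `|x - y| < e -> E (x, y).
  move: entE; rewrite -entourage_ballE => -[e /= e0 eE]; exists e => // x y xy.
  exact: eE.
move: e0; rewrite ltcE => /andP[/eqP ime ree].
have /cvgrPdist_lt/(_ _ ree) := eps0.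
apply: filterS => N; rewrite sub0r normrN => epsN; apply: ES => t Dt; apply: eE.
rewrite (csum_eq eps0 (fun N => Feps N t Dt)).
rewrite ltcE /= ime eqxx/=; apply: le_lt_trans (Feps N t Dt) _.
by apply: le_lt_trans epsN; exact: ler_norm.
Qed.

Lemma fact_double_ge n : (n`! <= (2 * n)`!)%N.
Proof. by apply: leq_fact; rewrite leq_pmull. Qed.

(** Since [n! <= (2 n)!], the terms are dominated by those of the exponential series at [K ^+ 2],
    with the same index [n]. *)
Lemma exp_term_even (K : R) n : 0 <= K ->
  K ^+ (2 * n) / (2 * n)`!%:R <= exp_coeff (K ^+ 2) n.
Proof.
move=> K0; rewrite exp_coeffE/= mulrC -exprM ler_wpM2r ?exprn_ge0//.
by rewrite lef_pV2 ?posrE ?ltr0n ?fact_gt0// ler_nat fact_double_ge.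
Qed.

Lemma exp_term_odd (K : R) n : 0 <= K ->
  K ^+ (2 * n + 1) / (2 * n + 1)`!%:R <= K * exp_coeff (K ^+ 2) n.
Proof.
move=> K0; rewrite exp_coeffE/= addn1 exprS -mulrA ler_wpM2l// mulrC -exprM.
rewrite ler_wpM2r ?exprn_ge0//.
rewrite lef_pV2 ?posrE ?ltr0n ?fact_gt0// ler_nat.
by rewrite (leq_trans (fact_double_ge n))// leq_fact.
Qed.

Lemma sum_even_odd (V : zmodType) (F : nat -> V) N :
  \sum_(0 <= k < 2 * N) F k = \sum_(0 <= n < N) (F (2 * n)%N + F (2 * n + 1)%N).
Proof.
elim: N => [|N IHN]; first by rewrite muln0 !big_nil.
have -> : (2 * N.+1 = (2 * N).+2)%N by rewrite mulnS.
rewrite [RHS]big_nat_recr//= -IHN. rewrite big_nat_recr//= big_nat_recr//=.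
by rewrite addn1 addrA.
Qed.

End UniformSums.

(** * Convergence and error bounds for the series of the Dirac system *)

Section DiracSeries.
Variable R : realType.
Variables (P Q : R -> R[i]) (lambda : R[i]).
Hypothesis hP : cintegrable `]0, pi[ P.
Hypothesis hQ : cintegrable `]0, pi[ Q.
Notation mu := (@lebesgue_measure R).

Let a := wP P lambda.
Let b := wQ Q lambda.
Let ia : cintegrable `[0, pi] a. Proof. exact: wP_cintegrable. Qed.
Let ib : cintegrable `[0, pi] b. Proof. exact: wQ_cintegrable. Qed.
Let w s := norm1c (a s) + norm1c (b s).
Let iw : mu.-integrable `[0, pi] (EFin \o w).
Proof.
have mI : measurable (`[0, pi]%classic : set (measurableTypeR R)) by [].
exact: (integrableD mI (integrable_norm1c mI ia) (integrable_norm1c mI ib)).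
Qed.
Let aw s : norm1c (a s) <= w s. Proof. by rewrite lerDl norm1c_ge0. Qed.
Let bw s : norm1c (b s) <= w s. Proof. by rewrite lerDr norm1c_ge0. Qed.
Let W t := \int[mu]_(s in `[0, t]) w s.

(** The primitive [W] is continuous on a compact interval, hence bounded; this removes [t] from the
    estimates. *)
Let W_bound : exists2 K : R, 0 <= K & forall (t : R) m, 0 <= t <= pi ->
  W t ^+ m / m`!%:R <= K ^+ m / m`!%:R.
Proof.
have [K K0 KP] := within_continuous_bounded (parameterized_integral_continuous (pi_ge0 R) iw).
exists K; first exact: ltW.
move=> t m tpi; rewrite ler_wpM2r ?invr_ge0//.
rewrite (le_trans (ler_norm _))// normrX.
by apply: lerXn2r; rewrite ?nnegrE ?normr_ge0 ?(ltW K0) ?KP.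
Qed.

(** Comparison with the exponential series at [K ^+ 2]. The case [r = 0] concerns [g_int] and
    [h_int], the case [r = 1] concerns [p_int] and [q_int]; the factor [1 + K] covers both. *)
Lemma normc_alt_series_cvg (r : nat) t : (r < 2)%N -> 0 <= t <= pi ->
  cvgn (series (fun n => Normc.normc (alt_integral a b (2 * n + r)%N t))) /\
  cvgn (series (fun n => Normc.normc (alt_integral b a (2 * n + r)%N t))).
Proof.
move=> r2 tpi; have [K K0 KP] := W_bound.
have bound n (f : R -> R[i]) : (forall s, 0 <= s <= pi ->
    norm1c (f s) <= W s ^+ (2 * n + r) / (2 * n + r)`!%:R) ->
    Normc.normc (f t) <= (1 + K) * exp_coeff (K ^+ 2) n.
  move=> fW; rewrite (le_trans (normc_le_norm1c _))// (le_trans (fW _ tpi))//.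
  rewrite (le_trans (KP _ _ tpi))//.
  have e0 : 0 <= exp_coeff (K ^+ 2) n by rewrite exp_coeff_ge0 ?exprn_ge0.
  case: r r2 {fW} => [|[|//]] _.
    rewrite addn0 (le_trans (exp_term_even _ K0))// ler_peMl// lerDl//.
  by rewrite (le_trans (exp_term_odd _ K0))// ler_wpM2r// lerDr.
have cvgK : cvgn (series (fun n => (1 + K) * exp_coeff (K ^+ 2) n)).
  by apply: is_cvg_seriesZ; exact: is_cvg_series_exp_coeff.
have K1 n : 0 <= (1 + K) * exp_coeff (K ^+ 2) n.
  by rewrite mulr_ge0 ?addr_ge0 ?exp_coeff_ge0 ?exprn_ge0.
have normc0 (z : R[i]) : 0 <= Normc.normc z.
  exact: le_trans (normr_ge0 _) (Re_le_normc z).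
split; apply: series_le_cvg cvgK => // n; apply: bound => s spi.
- exact: (norm1c_alt_integral (pi_ge0 R) iw _ ia ib (fun s _ => aw s) (fun s _ => bw s)).
- exact: (norm1c_alt_integral (pi_ge0 R) iw _ ib ia (fun s _ => bw s) (fun s _ => aw s)).
Qed.

(** The remainder is taken at order [2 * N], so that even and odd terms pair up into the [N]-th
    partial sums of two series. *)
Lemma dirac_column_series (y : R -> 'cV[R[i]]_2) : dirac_solution P Q lambda y ->
  let u t := cexp (- ('i%C * lambda * t%:C%C)) * y t 0 0 in
  let v t := cexp ('i%C * lambda * t%:C%C) * y t 1 0 in
  exists2 eps : R^nat, eps @ \oo --> (0 : R) & forall N t, 0 <= t <= pi ->
    Normc.normc (u t - \sum_(0 <= n < N)
      (u 0 * g_int P Q n t lambda + - 'i%C * v 0 * p_int P Q n t lambda)) <= eps N /\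
    Normc.normc (v t - \sum_(0 <= n < N)
      (v 0 * h_int P Q n t lambda + 'i%C * u 0 * q_int P Q n t lambda)) <= eps N.
Proof.
move=> hy u v; have [K K0 KP] := W_bound.
have [acu acv] := dirac_cac hy.
have [uE vE] := dirac_integral_equations hP hQ hy.
have cu := cac_ccontinuous (pi_ge0 R) acu.
have cv := cac_ccontinuous (pi_ge0 R) acv.
have [M M0 MP] := ccontinuous_bounded cu.
have [L L0 LP] := ccontinuous_bounded cv.
have uM s : 0 <= s <= pi -> norm1c (u s) <= M + L.
  by move=> /MP uM; rewrite (le_trans uM)// lerDl.
have vM s : 0 <= s <= pi -> norm1c (v s) <= M + L.
  by move=> /LP vL; rewrite (le_trans vL)// lerDr.
have ii : 'i%C * 'i%C = -1 :> R[i] by rewrite -expr2 sqr_i.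
have iN : 'i%C * - 'i%C = 1 :> R[i] by rewrite mulrN ii opprK.
have Ni : - 'i%C * 'i%C = 1 :> R[i] by rewrite mulNr ii opprK.
have i1 : norm1c ('i%C : R[i]) <= 1 by rewrite /norm1c /= normr0 normr1 add0r.
have Ni1 : norm1c (- 'i%C : R[i]) <= 1.
  by rewrite /norm1c /= oppr0 normrN normr0 normr1 add0r.
(* [M + L] bounds both [u] and [v]; the other factor dominates [K ^+ (2 * N) / (2 * N)!]. *)
exists (fun N => (M + L) * exp_coeff (K ^+ 2) N).
  by rewrite -(mulr0 (M + L)); apply: cvgMr; exact: cvg_exp_coeff.
have ML0 : 0 <= M + L by exact: addr_ge0.
move=> N t tpi; split.
- have := system_remainder (pi_ge0 R) iw (2 * N)%N ia ib (fun s _ => aw s) (fun s _ => bw s)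
    cu cv uM vM Ni Ni1 i1 uE vE tpi.
  rewrite sum_even_odd => H.
  rewrite (le_trans (normc_le_norm1c _))//.
  move: H; rewrite (eq_bigr (fun n => u 0 * g_int P Q n t lambda +
     - 'i%C * v 0 * p_int P Q n t lambda)); last first.
    by move=> n _; rewrite oddD oddM.
  move/le_trans; apply; rewrite ler_wpM2l// (le_trans (KP _ _ tpi))//.
  exact: exp_term_even.
- have := system_remainder (pi_ge0 R) iw (2 * N)%N ib ia (fun s _ => bw s) (fun s _ => aw s)
    cv cu vM uM iN i1 Ni1 vE uE tpi.
  rewrite sum_even_odd => H.
  rewrite (le_trans (normc_le_norm1c _))//.
  move: H; rewrite (eq_bigr (fun n => v 0 * h_int P Q n t lambda +
     'i%C * u 0 * q_int P Q n t lambda)); last first.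
    by move=> n _; rewrite oddD oddM.
  move/le_trans; apply; rewrite ler_wpM2l// (le_trans (KP _ _ tpi))//.
  exact: exp_term_even.
Qed.

(** Multiplication by the unimodular [d], inverse to [c], preserves the modulus and moves the
    constant from the terms to [s]. It serves to strip the factors [- 'i] and ['i] from the series
    of [p_int] and [q_int]. *)
Lemma normc_sub_sum (s c d : R[i]) (F : nat -> R[i]) N :
  d * c = 1 -> Normc.normc d = 1 ->
  Normc.normc (d * s - \sum_(0 <= n < N) F n) =
  Normc.normc (s - \sum_(0 <= n < N) c * F n).
Proof.
move=> dc d1; rewrite -[RHS]mul1r -d1 -Normc.normcM mulrBr -mulr_sumr.
by rewrite mulrA dc mul1r.
Qed.

End DiracSeries.

Theorem lemma2 (R : realType) (P Q : R -> R[i])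
    (E : R -> R[i] -> 'M[R[i]]_2)
    (hP : cintegrable `]0, pi[ P) (hQ : cintegrable `]0, pi[ Q)
    (hE : fundamental_matrix P Q E) (lambda : R[i]) :
  (forall t : R, 0 <= t <= pi ->
    [/\ E t lambda 0 1 = - 'i%C * cexp ('i%C * lambda * t%:C%C)
                         * csum (fun n => p_int P Q n t lambda),
        E t lambda 1 0 = 'i%C * cexp (- ('i%C * lambda * t%:C%C))
                         * csum (fun n => q_int P Q n t lambda),
        E t lambda 0 0 = cexp ('i%C * lambda * t%:C%C)
                         * csum (fun n => g_int P Q n t lambda) &
        E t lambda 1 1 = cexp (- ('i%C * lambda * t%:C%C))
                         * csum (fun n => h_int P Q n t lambda)]) /\
  [/\ cvg_abs_unif `[0, pi] (fun n t => p_int P Q n t lambda),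
      cvg_abs_unif `[0, pi] (fun n t => q_int P Q n t lambda),
      cvg_abs_unif `[0, pi] (fun n t => g_int P Q n t lambda) &
      cvg_abs_unif `[0, pi] (fun n t => h_int P Q n t lambda)].
Proof.
have [sol E0] := hE lambda.
pose em t : R[i] := cexp (- ('i%C * lambda * t%:C%C)).
pose ep t : R[i] := cexp ('i%C * lambda * t%:C%C).
have ep_em t : ep t * em t = 1 by rewrite mulrC; exact: cexpN_mul.
have em_ep t : em t * ep t = 1 by exact: cexpN_mul.
have em0 : em 0 = 1 by rewrite /em mulr0 oppr0 cexp0.
have ep0 : ep 0 = 1 by rewrite /ep mulr0 cexp0.
have ii : 'i%C * 'i%C = -1 :> R[i] by rewrite -expr2 sqr_i.
have iN : 'i%C * - 'i%C = 1 :> R[i] by rewrite mulrN ii opprK.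
have Ni : - 'i%C * 'i%C = 1 :> R[i] by rewrite mulNr ii opprK.
have n_i : Normc.normc ('i%C : R[i]) = 1 by rewrite /= expr0n expr1n add0r sqrtr1.
have n_Ni : Normc.normc (- 'i%C : R[i]) = 1 by rewrite /= oppr0 sqrrN expr0n expr1n add0r sqrtr1.
(* The columns of [E] start at [(1, 0)] and [(0, 1)], so one of the two series in each component
   drops out: the first column yields [g_int] and [q_int], the second [p_int] and [h_int]. *)
have [eps0 eps0_0 col0] := dirac_column_series hP hQ (sol 0).
have [eps1 eps1_0 col1] := dirac_column_series hP hQ (sol 1).
have gS N t : 0 <= t <= pi -> Normc.normc (em t * E t lambda 0 0 -
    \sum_(0 <= n < N) g_int P Q n t lambda) <= eps0 N.
  move=> /(col0 N)[+ _]; rewrite !mxE E0 -/(em t) -/(em 0) -/(ep 0) em0 !mxE/= !mulr1 !mulr0.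
  by under eq_bigr do rewrite mul1r mul0r addr0.
have qS N t : 0 <= t <= pi -> Normc.normc (- 'i%C * (ep t * E t lambda 1 0) -
    \sum_(0 <= n < N) q_int P Q n t lambda) <= eps0 N.
  rewrite (normc_sub_sum _ _ _ Ni n_Ni).
  move=> /(col0 N)[_ +]; rewrite !mxE E0 -/(ep t) -/(em 0) -/(ep 0) em0 !mxE/= !mulr1 !mulr0.
  by under eq_bigr do rewrite mul0r add0r.
have hS N t : 0 <= t <= pi -> Normc.normc (ep t * E t lambda 1 1 -
    \sum_(0 <= n < N) h_int P Q n t lambda) <= eps1 N.
  move=> /(col1 N)[_ +]; rewrite !mxE E0 -/(ep t) -/(em 0) -/(ep 0) ep0 !mxE/= !mulr1 !mulr0.
  by under eq_bigr do rewrite mul1r mul0r addr0.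
have pS N t : 0 <= t <= pi -> Normc.normc ('i%C * (em t * E t lambda 0 1) -
    \sum_(0 <= n < N) p_int P Q n t lambda) <= eps1 N.
  rewrite (normc_sub_sum _ _ _ iN n_i).
  move=> /(col1 N)[+ _]; rewrite !mxE E0 -/(em t) -/(em 0) -/(ep 0) ep0 !mxE/= !mulr1 !mulr0.
  by under eq_bigr do rewrite mul0r add0r.
split=> [t tpi|].
  rewrite (csum_eq eps1_0 (fun N => pS N t tpi)) (csum_eq eps0_0 (fun N => qS N t tpi)).
  rewrite (csum_eq eps0_0 (fun N => gS N t tpi)) (csum_eq eps1_0 (fun N => hS N t tpi)).
  rewrite -/(em t) -/(ep t); split.
  (* The left side is multiplied by [- 'i * 'i] and by [ep t * em t], both equal to 1, after which
     the two sides agree as polynomials. *)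
  - rewrite -[LHS]mul1r -[X in X * _]mul1r -{1}Ni -(ep_em t); ring.
  - rewrite -[LHS]mul1r -[X in X * _]mul1r -{1}iN -(em_ep t); ring.
  - by rewrite mulrA ep_em mul1r.
  - by rewrite mulrA em_ep mul1r.
have unif F l eps : eps @ \oo --> (0 : R) ->
    (forall N t, 0 <= t <= pi -> Normc.normc (l t - \sum_(0 <= n < N) F n t) <= eps N) ->
    (forall t, 0 <= t <= pi -> cvgn (series (fun n => Normc.normc (F n t)))) ->
    cvg_abs_unif `[0, pi] (F : nat -> R -> R[i]).
  move=> epsv Feps Fabs; split=> [t|]; first by rewrite /= in_itv/=; exact: Fabs.
  by apply: (uniform_csum epsv) => N t; rewrite /= in_itv/=; exact: Feps.
have abs0 t (tpi : 0 <= t <= pi) := @normc_alt_series_cvg R P Q lambda hP hQ 0 t isT tpi.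
have abs1 t (tpi : 0 <= t <= pi) := @normc_alt_series_cvg R P Q lambda hP hQ 1 t isT tpi.
split.
- by apply: (unif _ _ _ eps1_0 pS) => t /abs1[].
- by apply: (unif _ _ _ eps0_0 qS) => t /abs1[].
- by apply: (unif _ _ _ eps0_0 gS) => t /abs0[]; under eq_fun do rewrite addn0.
- by apply: (unif _ _ _ eps1_0 hS) => t /abs0[_]; under eq_fun do rewrite addn0.
Qed.
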